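(* If the wholesale price vector $\lambda$ and the local state $\omega^i$ are statistically independent for each customer $i=1,\dots,M$, then the optimal two-part tariff $T^*$ is an optimal solution of $$\max_{T(\cdot)}\ \overline{\mathsf{cs}}(T)\quad\text{s.t.}\quad\overline{\mathsf{rs}}(T)=F$$ among all arbitrary (possibly nonlinear) ex-ante tariffs $T:\mathbb{R}^N\to\mathbb{R}$ with the same lag time.
   Context: Model. Fix integers $N,M\ge 1$ and $F\in\mathbb{R}$. $\lambda$ is a random vector in $\mathbb{R}_+^N$ (wholesale prices) and, for $i=1,\dots,M$, $\omega^i=(\omega^i_1,\dots,\omega^i_N)$ is a random vector in $\mathbb{R}^N$ (local state of customer $i$); $\omega=(\omega^1,\dots,\omega^M)$. An overline denotes expectation, e.g. $\overline{\lambda}=\mathbb{E}[\lambda]$. Customer $i$ has a gross surplus function $S^i:\mathbb{R}^N\times\mathbb{R}^N\to\mathbb{R}$, $(q^i,\omega^i)\mapsto S^i(q^i,\omega^i)$, continuously differentiable. An ex-ante tariff is a deterministic function $T:\mathbb{R}^N\to\mathbb{R}$, announced a fixed lag time before the billing cycle (so it cannot depend on the realizations of $\lambda,\omega$; tariffs with the same lag time are all such deterministic functions, with expectations taken under the same distribution of $(\lambda,\omega)$). A causal policy is a map $\omega^i\mapsto q^i(\omega^i)\in\mathbb{R}^N$ whose $k$-th component depends only on $(\omega^i_1,\dots,\omega^i_k)$. Given $T$, customer $i$'s consumption $q^i(T,\omega^i)$ is a causal policy maximizing $\mathbb{E}[S^i(q^i(\omega^i),\omega^i)-T(q^i(\omega^i))]$.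 (Every customer pays the charge $T$; no customer opts out.) Define the expected consumer and retailer surplus $$\overline{\mathsf{cs}}(T)=\mathbb{E}\Big[\sum_{i=1}^M S^i(q^i(T,\omega^i),\omega^i)-T(q^i(T,\omega^i))\Big],\quad \overline{\mathsf{rs}}(T)=\mathbb{E}\Big[\sum_{i=1}^M T(q^i(T,\omega^i))-\lambda^\top q^i(T,\omega^i)\Big].$$ Demand. For affine tariffs $T(q)=A+\pi^\top q$ it is assumed that $q^i(T,\omega^i)$ depends on $T$ only through $\pi$, and one writes $D^i(\pi,\omega^i)=q^i(T,\omega^i)$. It is assumed that $D^i$ is componentwise nonnegative, continuously differentiable in $\pi$, and that $\nabla_\pi D^i$ is negative definite ($x^\top(\nabla_\pi D^i)x<0$ for all $x\ne0$; symmetry is not required). $D(\pi,\omega)=\sum_{i=1}^M D^i(\pi,\omega^i)$. Convention: in products with vectors, the $N\times N$ matrix $\nabla_\pi D$ has $(k,t)$ entry $\partial D_t/\partial\pi_k$. All expectations are assumed finite and differentiation may be exchanged with expectation. Define $\overline{\phi}(\pi)=\mathbb{E}[(\pi-\lambda)^\top D(\pi,\omega)]$. Standing assumption (Assumption 1): $g(\pi)=\mathbb{E}[\nabla_\pi D(\pi,\omega)(\pi-\lambda)]$ has a negative definite Jacobian matrix $\nabla g(\pi)$ for all $\pi$. Optimal two-part tariff: $T^*(q)=A^*+\pi^{*\top}q$ is the maximizer of $\overline{\mathsf{cs}}(T)$ subject to $\overline{\mathsf{rs}}(T)=F$ over all $T(q)=A+\pi^\top q$ with $A\in\mathbb{R},\pi\in\mathbb{R}^N$;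 it is characterized by $\pi^*=\overline{\lambda}+\mathbb{E}[\nabla_\pi D(\pi^*,\omega)]^{-1}\mathbb{E}[\nabla_\pi D(\pi^*,\omega)(\lambda-\overline{\lambda})]$ and $A^*=\frac1M(F-\overline{\phi}(\pi^* ))$. *)

(* Defs.v *)
(* MathComp-Analysis. Vectors of R^N are row vectors 'rV[R]_N; expectations are
   real-valued integrals (Rintegral) against the probability P. *)
From HB Require Import structures.
From mathcomp Require Import all_boot all_order all_algebra.
From mathcomp Require Import all_classical all_reals all_analysis.

Set Implicit Arguments.
Unset Strict Implicit.
Unset Printing Implicit Defensive.

Import Order.TTheory GRing.Theory Num.Theory.
Import numFieldNormedType.Exports.

Local Open Scope classical_set_scope.
Local Open Scope ring_scope.

Definition dotp (R : realType) (N : nat) (u v : 'rV[R]_N) : R :=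
  (u *m v^T) 0 0.

(* Symmetry is not required. *)
Definition negative_definite (R : realType) (N : nat) (A : 'M[R]_N) : Prop :=
  forall x : 'rV[R]_N, x != 0 -> (x *m A *m x^T) 0 0 < 0.

(* In finite dimension, continuity of the derivative is continuity of all
   directional derivatives. *)
Definition continuously_differentiable (R : realType) (V W : normedModType R)
    (f : V -> W) : Prop :=
  (forall x, differentiable f x) /\ (forall v, continuous (fun x => 'D_v f x)).

(* R^N with its Borel sigma-algebra. *)
Definition borelV (R : realType) (N : nat) :=
  g_sigma_algebraType (@open 'rV[R]_N).

Section Market.
Context (R : realType) (d : measure_display) (Omega : measurableType d).
Context (P : probability Omega R) (N M : nat).

Definition tariff := 'rV[R]_N -> R.
Definition policy := 'rV[R]_N -> 'rV[R]_N.

Definition random_vector (X : Omega -> 'rV[R]_N) : Prop :=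
  measurable_fun setT (X : Omega -> borelV R N).

Definition finite_expectation (X : Omega -> R) : Prop :=
  P.-integrable setT (EFin \o X).

Definition mean (X : Omega -> 'rV[R]_N) : 'rV[R]_N :=
  \row_k (\int[P]_x X x 0 k).

Definition independent (X Y : Omega -> 'rV[R]_N) : Prop :=
  forall A B : set (borelV R N), measurable A -> measurable B ->
    P (X @^-1` A `&` Y @^-1` B) = (P (X @^-1` A) * P (Y @^-1` B))%E.

(* For every price vector p and direction v, the pointwise derivative of f at p
   is integrable and its expectation is the derivative of the expectation. *)
Definition exchangeable (f : 'rV[R]_N -> Omega -> R) : Prop :=
  forall p v : 'rV[R]_N,
    [/\ finite_expectation (f p),
        finite_expectation (fun x => 'D_v (f^~ x) p) &
        is_derive p v (fun p' => \int[P]_x f p' x)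
                      (\int[P]_x 'D_v (f^~ x) p)].

Definition two_part (A : R) (p : 'rV[R]_N) : tariff := fun y => A + dotp p y.

(* q w only uses w_0, ..., w_k to choose its k-th component. *)
Definition causal (q : policy) : Prop :=
  forall (k : 'I_N) (w w' : 'rV[R]_N),
    (forall j : 'I_N, (j <= k)%N -> w 0 j = w' 0 j) -> q w 0 k = q w' 0 k.

Context (lambda : Omega -> 'rV[R]_N) (omega : 'I_M -> Omega -> 'rV[R]_N).
Context (S : 'I_M -> 'rV[R]_N -> 'rV[R]_N -> R).

(* Borel causal policies for which consumption, gross surplus and payment all
   have a finite expectation. *)
Record admissible_policy (i : 'I_M) (T : tariff) (q : policy) : Prop := {
  policy_borel : measurable_fun setT (q : borelV R N -> borelV R N);
  policy_causal : causal q;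
  policy_consumption :
    forall k, finite_expectation (fun x => q (omega i x) 0 k);
  policy_surplus :
    finite_expectation (fun x => S i (q (omega i x)) (omega i x));
  policy_payment : finite_expectation (fun x => T (q (omega i x))) }.

Definition payoff (i : 'I_M) (T : tariff) (q : policy) : R :=
  \int[P]_x (S i (q (omega i x)) (omega i x) - T (q (omega i x))).

Definition optimal_policy (i : 'I_M) (T : tariff) (q : policy) : Prop :=
  admissible_policy i T q /\
  forall q', admissible_policy i T q' -> payoff i T q' <= payoff i T q.

(* q T i is the consumption policy of customer i under T. An arbitrary tariff
   need not admit an optimal policy (e.g. when the payoff is unbounded); q is
   constrained only where one exists, and is otherwise meaningless. *)
Definition consumption_rule (q : tariff -> 'I_M -> policy) : Prop :=
  forall T i, (exists q', optimal_policy i T q') -> optimal_policy i T (q T i).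

Definition well_posed (T : tariff) : Prop :=
  forall i, exists q', optimal_policy i T q'.

Context (q : tariff -> 'I_M -> policy).

Definition cs (T : tariff) : R :=
  \int[P]_x \sum_(i < M)
     (S i (q T i (omega i x)) (omega i x) - T (q T i (omega i x))).

(* If lambda is integrable and independent of each omega i, the integrand is
   integrable for every well-posed T. *)
Definition rs (T : tariff) : R :=
  \int[P]_x \sum_(i < M)
     (T (q T i (omega i x)) - dotp (lambda x) (q T i (omega i x))).

(* T maximizes cs subject to rs = F over the class C of tariffs. *)
Definition optimal_tariff (C : set tariff) (F : R) (T : tariff) : Prop :=
  [/\ C T, well_posed T, rs T = F &
      forall T', C T' -> well_posed T' -> rs T' = F -> cs T' <= cs T].

Definition two_part_tariffs : set tariff :=
  [set T | exists A p, T = two_part A p].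

Context (D : 'I_M -> 'rV[R]_N -> policy).

(* The (k, t) entry of the library's jacobian of p |-> f p is the derivative of
   the t-th component of f along p_k, the convention for nabla_pi D.
   Demand is not required to be nonnegative: policies range over all of R^N, so
   nonnegative demand at every price would contradict demand_optimal (for p >= 0
   large, consuming -1 of each good is better). *)
Record demand_model : Prop := {
  demand_optimal : forall i A p, optimal_policy i (two_part A p) (D i p);
  demand_rule : forall i A p, q (two_part A p) i = D i p;
  demand_C1 : forall i w, continuously_differentiable (fun p => D i p w);
  demand_negdef :
    forall i w p, negative_definite (jacobian (fun p' => D i p' w) p);
  demand_exchange : forall i t, exchangeable (fun p x => D i p (omega i x) 0 t);
  demand_cost_exchange : forall i t,
    exchangeable (fun p x => lambda x 0 t * D i p (omega i x) 0 t);
  demand_surplus_exchange : forall i,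
    exchangeable (fun p x => S i (D i p (omega i x)) (omega i x)) }.

Definition aggregate_demand (p : 'rV[R]_N) (x : Omega) : 'rV[R]_N :=
  \sum_(i < M) D i p (omega i x).

(* E[nabla_pi D (pi - lambda)], the column vector being transposed. *)
Definition mean_marginal_markup (p : 'rV[R]_N) : 'rV[R]_N :=
  mean (fun x => (p - lambda x) *m (jacobian (aggregate_demand^~ x) p)^T).

Definition marginal_markup_monotone : Prop :=
  forall p, differentiable mean_marginal_markup p /\
    negative_definite (jacobian mean_marginal_markup p).

End Market.

(* Main.v *)
(* Independence makes the expected procurement cost of any policy of customer i
   equal to its cost at the mean wholesale price, so total expected surplus
   cs + rs under any tariff is the sum of the customers' payoffs, from the
   policies they choose, when facing the linear price E[lambda]. The demands at
   that price maximize this sum. A two-part tariff with that price and fixed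
   charge F / M earns the retailer exactly F, hence gives consumers at least as
   much as any tariff with rs = F; and T* does at least as well as that two-part
   tariff. *)
From HB Require Import structures.
Require Import Defs.
From mathcomp Require Import all_boot all_order all_algebra.
From mathcomp Require Import all_classical all_reals all_analysis.
From mathcomp Require Import measurable_realfun.
Import Order.TTheory GRing.Theory Num.Theory.
Import numFieldNormedType.Exports.

Local Open Scope classical_set_scope.
Local Open Scope ring_scope.

(** * Expectation of a product of independent real random variables *)

Section IndependentProduct.
Context {R : realType} {d : measure_display} {Omega : measurableType d}.
Context {P : probability Omega R} {X Y : Omega -> R}.
Hypotheses (mX : measurable_fun setT X) (mY : measurable_fun setT Y).
Hypothesis indep : forall A B : set R, measurable A -> measurable B ->
  P (X @^-1` A `&` Y @^-1` B) = (P (X @^-1` A) * P (Y @^-1` B))%E.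
Hypotheses (intX : finite_expectation P X) (intY : finite_expectation P Y).

HB.instance Definition _ := isMeasurableFun.Build _ _ _ _ X mX.
HB.instance Definition _ := isMeasurableFun.Build _ _ _ _ Y mY.

Let XY (x : Omega) : R * R := (X x, Y x).

Let measurable_XY : measurable_fun setT XY.
Proof. exact: measurable_fun_pair. Qed.

HB.instance Definition _ := isMeasurableFun.Build _ _ _ _ XY measurable_XY.

Let prodE (z : R * R) : \bar R := (z.1 * z.2)%:E.

Let measurable_prodE : measurable_fun [set: R * R] prodE.
Proof.
apply/measurable_EFinP; apply: measurable_funM.
  exact: measurable_fst.
exact: measurable_snd.
Qed.

(** Independence is agreement of the joint law with the product of the two laws on measurable
    rectangles, and a measure on the product is determined by these. *)
Let joint_distributionE (f : R * R -> \bar R) :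
  (\int[distribution P XY]_z f z =
   \int[distribution P X \x distribution P Y]_z f z)%E.
Proof.
apply: eq_measure_integral => A mA _; exact/esym/product_measure_unique.
Qed.

Let integrable_id (Z : {RV P >-> R}) : finite_expectation P Z ->
  (distribution P Z).-integrable setT EFin.
Proof.
by move=> ?; apply: integrable_pushforward => //; exact/measurable_EFinP.
Qed.

(** By Tonelli the integral of [|x * y|] splits into the product of the first absolute moments of
    [X] and [Y], both finite. *)
Let integrable_prodE :
  (distribution P X \x distribution P Y)%E.-integrable setT prodE.
Proof.
apply/integrable12ltyP => //.
have mabs : measurable_fun setT (fun y : R => `|y|%:E).
  by apply/measurable_EFinP; exact: normr_measurable.
under eq_integral => x _.
  under eq_integral do rewrite /prodE/= normrM EFinM.
  rewrite ge0_integralZl//.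
  over.
have [_ Xfin] := integrableP _ _ _ (integrable_id X intX).
have [_ Yfin] := integrableP _ _ _ (integrable_id Y intY).
rewrite ge0_integralZr//; last exact: integral_ge0.
apply: lte_mul_pinfty => //; first exact: integral_ge0.
by rewrite ge0_fin_numE ?integral_ge0.
Qed.

Lemma independent_finite_expectationM :
  finite_expectation P (fun x => X x * Y x).
Proof.
apply/integrableP; split.
  by apply/measurable_EFinP; exact: measurable_funM.
have [_] := integrableP _ _ _ integrable_prodE.
rewrite -joint_distributionE ge0_integral_distribution//.
exact: measurableT_comp.
Qed.

(** Once the integral is moved to the product law, Fubini applies: integrating out [y] leaves [x]
    times the mean of [Y]. *)
Lemma independent_expectationM :
  \int[P]_x (X x * Y x) = \int[P]_x X x * \int[P]_x Y x.
Proof.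
have -> : \int[P]_x (X x * Y x) =
    fine (\int[distribution P X \x distribution P Y]_z prodE z)%E.
  rewrite -joint_distributionE integral_distribution//.
  exact: independent_finite_expectationM.
rewrite -integral12_prod_meas1// /fubini_F.
have mean_distribution (Z : {RV P >-> R}) : finite_expectation P Z ->
    (\int[distribution P Z]_y y%:E = (\int[P]_x Z x)%:E)%E.
  move=> intZ; rewrite integral_distribution//.
  by rewrite /Rintegral fineK//; exact: integrable_fin_num.
under eq_integral => x _.
  under eq_integral do rewrite /prodE/= EFinM.
  rewrite integralZl//; last exact: integrable_id.
  rewrite mean_distribution//.
  over.
rewrite integralZr//; last exact: integrable_id.
by rewrite mean_distribution.
Qed.

End IndependentProduct.

(** * Linearity of real-valued expectations *)

Section FiniteExpectation.
Context {R : realType} {d : measure_display} {Omega : measurableType d}.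
Context {P : probability Omega R}.

Lemma finite_expectationD {f g : Omega -> R} :
  finite_expectation P f -> finite_expectation P g ->
  finite_expectation P (fun x => f x + g x).
Proof. by move=> intf intg; exact: (integrableD measurableT intf intg). Qed.

Lemma finite_expectationB {f g : Omega -> R} :
  finite_expectation P f -> finite_expectation P g ->
  finite_expectation P (fun x => f x - g x).
Proof. by move=> intf intg; exact: (integrableB measurableT intf intg). Qed.

Lemma finite_expectationZl (r : R) {f : Omega -> R} :
  finite_expectation P f -> finite_expectation P (fun x => r * f x).
Proof. by move=> intf; exact: (integrableZl measurableT r intf). Qed.

Lemma finite_expectation_cst (r : R) : finite_expectation P (fun=> r).
Proof. exact: finite_measure_integrable_cst. Qed.

Lemma finite_expectation_sum {I : Type} (s : seq I) {f : I -> Omega -> R} :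
  (forall i, finite_expectation P (f i)) ->
  finite_expectation P (fun x => \sum_(i <- s) f i x).
Proof.
move=> intf; rewrite /finite_expectation.
rewrite (_ : EFin \o _ = fun x => (\sum_(i <- s) (EFin \o f i) x)%E).
  by apply: integrable_sum => // i _; exact: intf.
by apply/funext => x; rewrite /= sumEFin.
Qed.

Lemma Rintegral_sum {I : Type} (s : seq I) {f : I -> Omega -> R} :
  (forall i, finite_expectation P (f i)) ->
  \int[P]_x (\sum_(i <- s) f i x) = \sum_(i <- s) \int[P]_x f i x.
Proof.
move=> intf; elim: s => [|i s IHs].
  under eq_Rintegral do rewrite big_nil.
  by rewrite big_nil Rintegral_cst// mul0r.
under eq_Rintegral do rewrite big_cons.
rewrite big_cons -IHs RintegralD//; first exact: intf.
exact: finite_expectation_sum.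
Qed.

Lemma Rintegral_add_cst (r : R) {f : Omega -> R} : finite_expectation P f ->
  \int[P]_x (r + f x) = r + \int[P]_x f x.
Proof.
move=> intf; rewrite RintegralD//; last exact: finite_expectation_cst.
rewrite Rintegral_cst// (_ : fine _ = fine 1%E) ?mulr1//.
by congr fine; exact: probability_setT.
Qed.

End FiniteExpectation.

(** * Coordinates of row vectors *)

Lemma dotpE {R : realType} {N : nat} (u v : 'rV[R]_N) :
  dotp u v = \sum_k u 0 k * v 0 k.
Proof. by rewrite /dotp mxE; apply: eq_bigr => k _; rewrite mxE. Qed.

(** Open intervals generate the Borel sets of the line, and their preimages under the continuous
    coordinate map are open. *)
Lemma measurable_coord {R : realType} {N : nat} (k : 'I_N) :
  measurable_fun setT ((fun v : 'rV[R]_N => v 0 k) : borelV R N -> R).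
Proof.
apply: (measurability _ (RGenOpens.measurableE R)).
move=> _ [_ [a [b ->]] <-]; apply: sub_sigma_algebra; rewrite setTI.
by move/continuousP: (@coord_continuous R 1 N 0 k); apply; exact: interval_open.
Qed.

(** * Expected procurement cost under independence *)

Section Welfare.
Context {R : realType} {d : measure_display} {Omega : measurableType d}.
Context {P : probability Omega R} {N M : nat}.
Context {lambda : Omega -> 'rV[R]_N} {omega : 'I_M -> Omega -> 'rV[R]_N}.
Context {S : 'I_M -> 'rV[R]_N -> 'rV[R]_N -> R}.
Hypotheses (lambda_rv : random_vector lambda)
  (lambda_fin : forall k, finite_expectation P (fun x => lambda x 0 k))
  (omega_rv : forall i, random_vector (omega i))
  (indep : forall i, independent P lambda (omega i)).

Let lbar := mean P lambda.

Section Procurement.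
Context {i : 'I_M} {T : tariff R N} {y : policy R N}.
Hypothesis adm_y : admissible_policy P omega S i T y.

Let y_fin k : finite_expectation P (fun x => y (omega i x) 0 k).
Proof. by have [] := adm_y. Qed.

Let borel_coord k :
  measurable_fun setT ((fun w => y w 0 k) : borelV R N -> R).
Proof.
have [my _ _ _ _] := adm_y.
exact: measurableT_comp (measurable_coord k) my.
Qed.

Let lambda_coord k : measurable_fun setT (fun x => lambda x 0 k).
Proof. exact: measurableT_comp (measurable_coord k) lambda_rv. Qed.

Let y_coord k : measurable_fun setT (fun x => y (omega i x) 0 k).
Proof. exact: measurableT_comp (borel_coord k) (omega_rv i). Qed.

(** A policy is a Borel function of the customer's own local state, so an event about
    [y (omega i x) 0 k] is an event about [omega i]. *)
Let indep_coord k (A B : set R) : measurable A -> measurable B ->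
  P ((fun x => lambda x 0 k) @^-1` A `&` (fun x => y (omega i x) 0 k) @^-1` B) =
  (P ((fun x => lambda x 0%R k) @^-1` A) *
   P ((fun x => y (omega i x) 0%R k) @^-1` B))%E.
Proof.
move=> mA mB.
apply: (indep i ((fun v : borelV R N => v 0 k) @^-1` A)
                ((fun w : borelV R N => y w 0 k) @^-1` B)).
  by rewrite -[X in measurable X]setTI; exact: measurable_coord.
by rewrite -[X in measurable X]setTI; exact: borel_coord.
Qed.

Lemma finite_expectation_dotp (p : 'rV[R]_N) :
  finite_expectation P (fun x => dotp p (y (omega i x))).
Proof.
under eq_fun do rewrite dotpE.
by apply: finite_expectation_sum => k; exact: finite_expectationZl.
Qed.

Lemma finite_expectation_procurement :
  finite_expectation P (fun x => dotp (lambda x) (y (omega i x))).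
Proof.
under eq_fun do rewrite dotpE.
apply: finite_expectation_sum => k.
exact: (independent_finite_expectationM (lambda_coord k) (y_coord k)
  (indep_coord k) (lambda_fin k) (y_fin k)).
Qed.

(** Each price coordinate is independent of the matching coordinate of consumption, so the
    expectation factors term by term. *)
Lemma mean_procurement : \int[P]_x dotp (lambda x) (y (omega i x)) =
  \int[P]_x dotp lbar (y (omega i x)).
Proof.
under eq_Rintegral do rewrite dotpE.
under [RHS]eq_Rintegral do rewrite dotpE.
rewrite !Rintegral_sum.
- apply: eq_bigr => k _; rewrite (independent_expectationM (lambda_coord k)
    (y_coord k) (indep_coord k) (lambda_fin k) (y_fin k)).
  by rewrite RintegralZl ?mxE//; exact: y_fin.
- by move=> k; exact: finite_expectationZl.
- by move=> k; exact: (independent_finite_expectationM (lambda_coord k)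
    (y_coord k) (indep_coord k) (lambda_fin k) (y_fin k)).
Qed.

(** Admissibility involves the tariff only through the payment, which is here affine in an
    integrable consumption. A policy chosen under any tariff can thus compete with the demands at a
    linear price. *)
Lemma admissible_two_part (A : R) (p : 'rV[R]_N) :
  admissible_policy P omega S i (two_part A p) y.
Proof.
case: adm_y => ? ? ? ? ?; split=> //.
apply: finite_expectationD; first exact: finite_expectation_cst.
exact: finite_expectation_dotp.
Qed.

Lemma payoff_two_part (A : R) (p : 'rV[R]_N) :
  payoff P omega S i (two_part A p) y =
  \int[P]_x S i (y (omega i x)) (omega i x) -
  (A + \int[P]_x dotp p (y (omega i x))).
Proof.
have [_ _ _ S_fin T_fin] := admissible_two_part A p.
rewrite /payoff RintegralB// Rintegral_add_cst//.
exact: finite_expectation_dotp.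
Qed.

End Procurement.

(** * Retailer, consumer and total surplus under a well-posed tariff *)

Context {q : tariff R N -> 'I_M -> policy R N}.
Hypothesis q_rule : consumption_rule P omega S q.

Section Tariff.
Context {T : tariff R N}.
Hypothesis wpT : well_posed P omega S T.

Let adm i : admissible_policy P omega S i T (q T i).
Proof. by have [] := q_rule T i (wpT i). Qed.

Lemma rsE : rs P lambda omega q T =
  \sum_(i < M) (\int[P]_x T (q T i (omega i x)) -
                \int[P]_x dotp lbar (q T i (omega i x))).
Proof.
rewrite /rs Rintegral_sum => [|i].
  apply: eq_bigr => i _; have [_ _ _ _ T_fin] := adm i.
  by rewrite RintegralB ?(mean_procurement (adm i))//;
    exact: finite_expectation_procurement (adm i).
have [_ _ _ _ T_fin] := adm i.
by apply: finite_expectationB => //;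
  exact: finite_expectation_procurement (adm i).
Qed.

Lemma csE : cs P omega S q T =
  \sum_(i < M) (\int[P]_x S i (q T i (omega i x)) (omega i x) -
                \int[P]_x T (q T i (omega i x))).
Proof.
rewrite /cs Rintegral_sum => [|i]; have := adm.
  by move=> admT; apply: eq_bigr => i _; case: (admT i) => *; rewrite RintegralB.
by case/(_ i) => *; exact: finite_expectationB.
Qed.

(** Payments are transfers and cancel. What remains is gross surplus minus consumption valued at
    [lbar], so [T] matters only through the policies it induces. *)
Lemma welfareE : cs P omega S q T + rs P lambda omega q T =
  \sum_(i < M) payoff P omega S i (two_part 0 lbar) (q T i).
Proof.
rewrite csE rsE -big_split; apply: eq_bigr => i _ /=.
by rewrite (payoff_two_part (adm i)) add0r addrA subrK.
Qed.

End Tariff.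

End Welfare.

(** * Comparison of an arbitrary tariff with pricing at the mean wholesale price *)

Theorem theorem3 (R : realType) (d : measure_display) (Omega : measurableType d)
    (P : probability Omega R) (N M : nat) (F : R)
    (lambda : Omega -> 'rV[R]_N) (omega : 'I_M -> Omega -> 'rV[R]_N)
    (S : 'I_M -> 'rV[R]_N -> 'rV[R]_N -> R)
    (q : tariff R N -> 'I_M -> policy R N)
    (D : 'I_M -> 'rV[R]_N -> policy R N)
    (Astar : R) (pistar : 'rV[R]_N)
    (N_gt0 : (0 < N)%N) (M_gt0 : (0 < M)%N)
    (lambda_rv : random_vector lambda)
    (lambda_ge0 : forall x k, 0 <= lambda x 0 k)
    (lambda_fin : forall k, finite_expectation P (fun x => lambda x 0 k))
    (omega_rv : forall i, random_vector (omega i))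
    (S_C1 : forall i, continuously_differentiable
       (fun z : 'rV[R]_N * 'rV[R]_N => S i z.1 z.2))
    (q_rule : consumption_rule P omega S q)
    (D_demand : demand_model P lambda omega S q D)
    (markup_monotone : marginal_markup_monotone P lambda omega D)
    (indep : forall i, independent P lambda (omega i))
    (Tstar_opt : optimal_tariff P lambda omega S q (@two_part_tariffs R N) F
       (two_part Astar pistar)) :
  optimal_tariff P lambda omega S q setT F (two_part Astar pistar).
Proof.
have [_ Tstar_wp Tstar_rs Tstar_max] := Tstar_opt.
split=> // T _ T_wp T_rs.
set lbar := mean P lambda.
pose T1 := two_part (F / M%:R) lbar.
have D_opt i A : optimal_policy P omega S i (two_part A lbar) (D i lbar).
  exact: demand_optimal D_demand i A lbar.
have T1_wp : well_posed P omega S T1.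
  by move=> i; exists (D i lbar); exact: D_opt.
have T1_rs : rs P lambda omega q T1 = F.
  rewrite (rsE lambda_rv lambda_fin omega_rv indep q_rule T1_wp).
  transitivity (\sum_(i < M) (F / M%:R)).
    apply: eq_bigr => i _; rewrite (demand_rule D_demand).
    have [adm _] := D_opt i 0.
    (* At price [lbar] the usage charge offsets the expected procurement cost exactly, leaving the
       fixed charge. *)
    by rewrite Rintegral_add_cst ?addrK//;
      exact: finite_expectation_dotp adm lbar.
  (* The [M] equal shares add up to [F] because [M] is positive. *)
  rewrite sumr_const card_ord -[LHS]mulr_natr divfK//.
  by rewrite pnatr_eq0 -lt0n.
apply: (@le_trans _ _ (cs P omega S q T1)); last first.
  by apply: Tstar_max => //; exists (F / M%:R), lbar.
(* Both tariffs give the retailer [F], so adding it to each side turns consumer surplus into total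
   surplus. *)
rewrite -(lerD2r F) -{1}T_rs -T1_rs.
rewrite !(welfareE lambda_rv lambda_fin omega_rv indep q_rule)//.
apply: ler_sum => i _; rewrite (demand_rule D_demand).
(* Total surplus is expressed at fixed charge 0, where [D i lbar] is optimal too since demand does
   not vary with the fixed charge. *)
have [_] := D_opt i 0; apply.
have [adm _] := q_rule T i (T_wp i).
exact: admissible_two_part adm _ _.
Qed.
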